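(* There exists a metric space that admits a Lipschitz mixer but does not admit a Lipschitz co-mixer, and there exists a metric space that admits a Lipschitz co-mixer but does not admit a Lipschitz mixer.
   Context: Let $X$ be a metric space. A mixer on $X$ is a continuous map $\sigma\colon X^3\to X$ such that $\sigma(a,a,b)=\sigma(a,b,a)=\sigma(b,a,a)=a$ for all $a,b\in X$. A co-mixer on $X$ is a continuous map $\tau\colon X^3\to X$ such that $\tau(a,a,b)=\tau(a,b,a)=\tau(b,a,a)=b$ for all $a,b\in X$. Such an operation is called Lipschitz if it is Lipschitz as a map from $X^3$ (with, e.g., the maximum or sum product metric) to $X$; equivalently, there is a constant $L$ such that it is $L$-Lipschitz in each of its three variables separately (for all fixed values of the other two). *)

(* Defs.v *)
From HB Require Import structures.
From mathcomp Require Import all_boot all_order all_algebra.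
From mathcomp Require Import boolp classical_sets reals topology.

Set Implicit Arguments.
Unset Strict Implicit.
Unset Printing Implicit Defensive.

Import Order.TTheory GRing.Theory Num.Theory.

Local Open Scope classical_set_scope.
Local Open Scope ring_scope.

Section Mixers.
Context {R : realType} {X : metricType R}.

(* The library topologizes products of metric spaces, but provides no distance
   on them; this is the maximum metric, which induces the product topology. *)
Definition mdist3 (p q : X * X * X) : R :=
  Num.max (Num.max (mdist p.1.1 q.1.1) (mdist p.1.2 q.1.2)) (mdist p.2 q.2).

Definition lipschitz3 (f : X * X * X -> X) : Prop :=
  exists L : R, forall p q, mdist (f p) (f q) <= L * mdist3 p q.

Definition mixer (s : X * X * X -> X) : Prop :=
  continuous s /\
  forall a b, [/\ s (a, a, b) = a, s (a, b, a) = a & s (b, a, a) = a].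

Definition comixer (t : X * X * X -> X) : Prop :=
  continuous t /\
  forall a b, [/\ t (a, a, b) = b, t (a, b, a) = b & t (b, a, a) = b].

End Mixers.

Definition admits_lipschitz_mixer (R : realType) (X : metricType R) : Prop :=
  exists s : X * X * X -> X, mixer s /\ lipschitz3 s.

Definition admits_lipschitz_comixer (R : realType) (X : metricType R) : Prop :=
  exists t : X * X * X -> X, comixer t /\ lipschitz3 t.

(* Main.v *)
Require Import Defs.
From HB Require Import structures.
From mathcomp Require Import all_boot all_order all_algebra.
From mathcomp Require Import boolp classical_sets reals topology.
From mathcomp Require Import zify lra.

(** A subset of the line separates the two notions in one direction.  On any
    set of reals the median is a 1-Lipschitz mixer.  Take the half-line of
    nonpositive numbers together with the points [1/n].  A co-mixer [t] sends
    [(-1, -1, c)] to [c].  Move the second argument from [-1] to [0] while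
    [c = 1/n] stays fixed: the value moves continuously, so it cannot jump over
    the gap just below [c], and [t (-1, 0, c) >= c > 0] for every [n].  But
    [t (-1, 0, 0) = -1], and [c] tends to [0].  This is
    [gapped_line_no_comixer]; the Lipschitz condition allows the motion to be
    made in finitely many small steps.

    In the other direction the obstruction is a fundamental group.  A mixer
    contracts every loop: [s (g i, g j, o)] restricts to the loop [g] on the
    diagonal and is constant when [j] or [i] is at the base point [o].  A
    Boolean group with an invariant metric, on the other hand, has the
    co-mixer [a + b + c].  The folded cube, i.e. the Hamming cube of dimension
    [N + 1] with antipodal points identified, is such a group, and at scales
    much below its diameter it behaves like a real projective space: the path
    from the origin to its antipode becomes a loop of length [N + 1] that is
    contractible only through steps of size proportional to [N].  A Lipschitz
    mixer with constant [K] would contract it through steps of size [K], which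
    is impossible for large [N] ([folded_cubes_no_mixer]).  The space is the
    disjoint union of the folded cubes of all dimensions, rescaled to diameter
    at most [1].

    Noncontractibility is proved with a cocycle modulo 2.  A short step between
    two points of the folded cube lifts to a short step of the double cover,
    and [crossing] records whether that lift changes sheets; it is additive
    on small triangles ([crossing_cocycle]), hence its sum along a loop is a
    homotopy invariant ([winding_homotopy]). *)

Set Implicit Arguments.
Unset Strict Implicit.
Unset Printing Implicit Defensive.

Import Order.TTheory GRing.Theory Num.Theory.

Local Open Scope ring_scope.

(** * Lipschitz ternary operations *)

Lemma mdist3_triple_le (R : realType) (X : metricType R) (a b c a' b' c' : X)
    (e : R) :
  (mdist3 (a, b, c) (a', b', c') <= e) =
  [&& mdist a a' <= e, mdist b b' <= e & mdist c c' <= e].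
Proof. by rewrite /mdist3 /= !ge_max andbA. Qed.

Lemma lipschitz3_constant (R : realType) (X : metricType R)
    (f : X * X * X -> X) : lipschitz3 f ->
  exists2 K : R, 0 < K &
    forall p q e, mdist3 p q <= e -> mdist (f p) (f q) <= K * e.
Proof.
move=> [L fL]; exists (`|L| + 1) => [|p q e pqe]; first by rewrite ltr_pwDr.
apply: le_trans (fL p q) _.
have m0 : 0 <= mdist3 p q by rewrite /mdist3 !le_max mdist_ge0.
have := ler_norm L; have := normr_ge0 L; nra.
Qed.

Lemma lipschitz3_continuous (R : realType) (X : metricType R)
    (f : X * X * X -> X) : lipschitz3 f -> continuous f.
Proof.
move=> /lipschitz3_constant[K K0 fK] [[a b] c].
apply/metricType_numDomainType.cvgrPdist_le => e e0.
have d0 : 0 < e / K by rewrite divr_gt0.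
exists ((ball a (e / K) `*` ball b (e / K))%classic, ball c (e / K)).
  split => /=; last exact: nbhsx_ballx.
  exists (ball a (e / K), ball b (e / K)) => //.
  by split => /=; exact: nbhsx_ballx.
move=> [[a' b'] c'] /= [[]] /=; rewrite !ballEmdist /= => aa' bb' cc'.
rewrite -[e](@divfK _ K) ?gt_eqF // mulrC.
by apply: fK; rewrite mdist3_triple_le !ltW.
Qed.

(** * A set of reals with a Lipschitz mixer and no Lipschitz co-mixer *)

Definition in_gapped_line (R : realType) (x : R) : bool :=
  (x <= 0) || (x^-1 \is a Num.nat).

Definition gapped_line (R : realType) := {x : R | in_gapped_line x}.

Definition line_point (R : realType) (x : R) (xX : in_gapped_line x) :
  gapped_line R := exist _ x xX.

HB.instance Definition _ (R : realType) := Choice.on (gapped_line R).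

Definition line_dist (R : realType) (x y : gapped_line R) : R :=
  `|val x - val y|.

Lemma line_distxx (R : realType) (x : gapped_line R) : line_dist x x = 0.
Proof. by rewrite /line_dist subrr normr0. Qed.

Lemma line_dist_eq0 (R : realType) (x y : gapped_line R) :
  line_dist x y = 0 -> x = y.
Proof.
by move=> /normr0_eq0/eqP; rewrite subr_eq0 => /eqP xy; apply: val_inj.
Qed.

Lemma line_distC (R : realType) (x y : gapped_line R) :
  line_dist x y = line_dist y x.
Proof. exact: distrC. Qed.

Lemma line_dist_triangle (R : realType) (y x z : gapped_line R) :
  line_dist x z <= line_dist x y + line_dist y z.
Proof. exact: ler_distD. Qed.

HB.instance Definition _ (R : realType) :=
  @isMetric.Build R (gapped_line R) _ (@line_distxx R) (@line_dist_eq0 R)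
    (@line_distC R) (@line_dist_triangle R).

Definition median (d : Order.disp_t) (T : orderType d) (x y z : T) : T :=
  Order.max (Order.min x y) (Order.max (Order.min x z) (Order.min y z)).

(** The median is one of its arguments, so every set of reals is closed under
    it. *)
Lemma median_choice (d : Order.disp_t) (T : orderType d) (P : T -> Prop)
  (x y z : T) : P x -> P y -> P z -> P (median x y z).
Proof.
move=> Px Py Pz; rewrite /median !minElt !maxElt.
by do 10?[case: ifP => _].
Qed.

Lemma median_majority (d : Order.disp_t) (T : orderType d) (x y : T) :
  [/\ median x x y = x, median x y x = x & median y x x = x].
Proof.
by rewrite /median; split; case: (ltgtP x y) => [xy|xy|->];
  rewrite ?minxx ?maxxx ?(max_l (ltW xy)) ?(max_r (ltW xy))
  ?(max_l (lexx _)) ?(ltW xy).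
Qed.

Lemma median_close (R : realDomainType) (x y z x' y' z' e : R) :
  `|x - x'| <= e -> `|y - y'| <= e -> `|z - z'| <= e ->
  `|median x y z - median x' y' z'| <= e.
Proof.
have close_max (a b a' b' : R) : `|a - a'| <= e -> `|b - b'| <= e ->
    `|Num.max a b - Num.max a' b'| <= e.
  by rewrite !ler_norml; case: (leP a b); case: (leP a' b'); lra.
have close_min (a b a' b' : R) : `|a - a'| <= e -> `|b - b'| <= e ->
    `|Num.min a b - Num.min a' b'| <= e.
  by rewrite !ler_norml; case: (leP a b); case: (leP a' b'); lra.
by move=> xx' yy' zz'; apply: (close_max _ _ _ _ _ (close_max _ _ _ _ _ _));
  exact: close_min.
Qed.

Lemma gapped_line_gap (R : realType) (x : gapped_line R) (m : nat) :
  m.+2%:R^-1 < val x -> m.+1%:R^-1 <= val x.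
Proof.
case: x => x /= /orP[x0|/natrP[k xk]] mx.
  by have := lt_le_trans mx x0; rewrite invr_lt0 ltrn0.
have x0 : 0 < x by apply: lt_trans mx; rewrite invr_gt0.
move: mx; rewrite -(invrK x) !xk.
have k0 : (0 < k)%N by rewrite -(ltr_nat R) -xk invr_gt0.
by rewrite ltf_pV2 ?lef_pV2 ?posrE ?ltr0n // ltr_nat ler_nat ltnS.
Qed.

Lemma gapped_line_mixer (R : realType) : admits_lipschitz_mixer (gapped_line R).
Proof.
pose s (p : gapped_line R * gapped_line R * gapped_line R) : gapped_line R :=
  line_point (median_choice (P := in_gapped_line (R := R))
    (valP p.1.1) (valP p.1.2) (valP p.2)).
have sL : lipschitz3 s.
  exists 1 => -[[a b] c] [[a' b'] c']; rewrite mul1r.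
  have := lexx (mdist3 (a, b, c) (a', b', c')).
  rewrite {1}mdist3_triple_le => /and3P[aa' bb' cc'].
  exact: median_close aa' bb' cc'.
exists s; split=> //; split; first exact: lipschitz3_continuous.
by move=> a b; have [? ? ?] := median_majority (val a) (val b);
  split; apply: val_inj.
Qed.

(** With [c = 1/(m + 1)] and [K < m + 1], the points [t (-1, 0, c)] and
    [t (-1, 0, 0) = -1] are at distance at most [K * c < 1], although the former
    cannot have dropped below [c]. *)
Lemma gapped_line_no_comixer (R : realType) :
  ~ admits_lipschitz_comixer (gapped_line R).
Proof.
move=> [t [[_ tE] /lipschitz3_constant[K K0 tK]]].
(* The minimum with 0 makes [neg] total; it is the identity on [-1, 0]. *)
have neg_in (x : R) : in_gapped_line (Num.min 0 x).
  by rewrite /in_gapped_line ge_min lexx.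
pose neg (x : R) : gapped_line R := line_point (neg_in x).
have negE x y : mdist (neg x) (neg y) <= `|x - y|.
  rewrite {1}/mdist /= /line_dist /=.
  by rewrite ler_normr !ler_norml; case: (leP 0 x); case: (leP 0 y); lra.
pose m := Num.bound K.
have Km : K < m.+1%:R.
  by rewrite (lt_trans (archi_boundP (ltW K0))) // ltr_nat.
have c_in : in_gapped_line (m.+1%:R^-1 : R).
  by rewrite /in_gapped_line invrK natr_nat orbT.
pose c : gapped_line R := line_point c_in.
pose g : R := m.+1%:R^-1 - m.+2%:R^-1.
have g0 : 0 < g by rewrite subr_gt0 ltf_pV2 ?posrE ?ltr0n // ltr_nat.
(* Steps of length 1/M move the value by less than the gap g. *)
pose M := Num.bound (K / g).
have KM : K / g < M%:R by apply: archi_boundP; rewrite ltW ?divr_gt0.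
have M0 : 0 < M%:R :> R by apply: le_lt_trans KM; rewrite ltW ?divr_gt0.
pose b j := neg (-1 + j%:R / M%:R).
have stay j : val c <= val (t (b 0, b j, c)).
  elim: j => [|j IHj]; first by have [-> _ _] := tE (b 0) c.
  apply: gapped_line_gap.
  have : mdist (t (b 0, b j, c)) (t (b 0, b j.+1, c)) <= K * M%:R^-1.
    apply: tK; rewrite mdist3_triple_le !mdistxx invr_ge0 ltW //= andbT.
    apply: le_trans (negE _ _) _; rewrite -natr1 mulrDl mul1r.
    have : 0 < M%:R^-1 :> R by rewrite invr_gt0.
    by rewrite ler_norml; lra.
  have : K * M%:R^-1 < g by rewrite ltr_pdivrMr // mulrC -ltr_pdivrMr.
  rewrite {1}/mdist /= /line_dist ler_norml => KMg /andP[_].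
  move: IHj KMg; rewrite /g /=.
  by move: (m.+1%:R^-1 : R) (m.+2%:R^-1 : R) (K / M%:R) => u v w; lra.
have b0 : val (b 0) = -1.
  by rewrite /b /= mul0r addr0; apply: min_r; lra.
have bM : val (b M) = 0.
  by rewrite /b /= divff ?gt_eqF // addNr minxx.
have : mdist (t (b 0, b M, c)) (t (b 0, b M, b M)) <= K * val c.
  apply: tK; rewrite mdist3_triple_le !mdistxx invr_ge0 ler0n /=.
  by rewrite /mdist /= /line_dist bM subr0 ger0_norm ?invr_ge0.
have [_ _ ->] := tE (b M) (b 0).
rewrite {1}/mdist /= /line_dist b0 ler_norml => /andP[_].
have : K * m.+1%:R^-1 < 1 by rewrite ltr_pdivrMr // mul1r.
have := stay M; have : 0 < m.+1%:R^-1 :> R by rewrite invr_gt0.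
by rewrite /=; move: (K / m.+1%:R) (m.+1%:R^-1 : R) => u v; lra.
Qed.


(** * Folded cubes *)

Definition hamming (x y : seq bool) : nat :=
  \sum_(i < size x) (nth false x i != nth false y i).

Lemma hammingxx x : hamming x x = 0%N.
Proof. by apply: big1 => i _; rewrite eqxx. Qed.

Lemma hammingC x y : size x = size y -> hamming x y = hamming y x.
Proof.
by rewrite /hamming => ->; apply: eq_bigr => i _; rewrite eq_sym.
Qed.

Lemma hamming_eq0 x y : size x = size y -> hamming x y = 0%N -> x = y.
Proof.
move=> xy /eqP; rewrite sum_nat_eq0 => /forallP h.
apply: (eq_from_nth (x0 := false)) => // i ix.
by have := h (Ordinal ix); rewrite /= eqb0 negbK => /eqP.
Qed.

Lemma hamming_le_size x y : (hamming x y <= size x)%N.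
Proof.
by rewrite -[leqRHS]card_ord -sum1_card; apply: leq_sum => i _; case: eqP.
Qed.

Lemma hamming_triangle x y z : size x = size y ->
  (hamming x z <= hamming x y + hamming y z)%N.
Proof.
rewrite /hamming => <-; rewrite -big_split /=; apply: leq_sum => i _.
by case: (nth _ x _); case: (nth _ y _); case: (nth _ z _).
Qed.

(** Among three bits, zero or two of the three pairs differ. *)
Lemma hamming_perimeter x y z : size x = size y ->
  (hamming x y + hamming y z + hamming x z <= 2 * size x)%N.
Proof.
rewrite /hamming => <-; rewrite -!big_split /= mulnC.
rewrite -[X in (_ <= X * _)%N]card_ord.
rewrite -sum_nat_const; apply: leq_sum => i _.
by case: (nth _ x _); case: (nth _ y _); case: (nth _ z _).
Qed.

(** Points of the cube of dimension [N + 1] modulo antipodes have a unique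
    representative with last bit 0, hence are words [x] of length [N].  The
    antipode of [y] is at distance [N + 1 - hamming x y] from [x], the extra 1
    coming from the last bit. *)
Definition folded (x y : seq bool) : nat :=
  minn (hamming x y) ((size x).+1 - hamming x y).

Lemma foldedC x y : size x = size y -> folded x y = folded y x.
Proof. by move=> xy; rewrite /folded (hammingC xy) xy. Qed.

(** Replacing both edges at [y] by their antipodal versions uses the bound on
    the perimeter; replacing one of them, the triangle inequality of the
    cube. *)
Lemma folded_triangle x y z : size x = size y -> size y = size z ->
  (folded x z <= folded x y + folded y z)%N.
Proof.
move=> xy yz; have xz := etrans xy yz.
have := hamming_triangle z xy; have := hamming_perimeter z xy.
have := hamming_triangle y xz; have := hamming_triangle z (esym xy).
rewrite (hammingC (esym xy)) (hammingC (esym yz)) /folded -xy.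
by have := hamming_le_size x y; have := hamming_le_size x z; lia.
Qed.

(** A word lies in the component given by its length, so that the words of
    all lengths form the disjoint union of the folded cubes. *)
Definition folded_cubes (R : realType) := seq bool.

HB.instance Definition _ (R : realType) := Choice.on (folded_cubes R).

Definition cube_dist (R : realType) (x y : folded_cubes R) : R :=
  if size x == size y then (folded x y)%:R / (size x).+1%:R else 1.

Lemma cube_dist_ge0 (R : realType) (x y : folded_cubes R) : 0 <= cube_dist x y.
Proof. by rewrite /cube_dist; case: ifP => // _; rewrite divr_ge0. Qed.

Lemma cube_dist_le1 (R : realType) (x y : folded_cubes R) : cube_dist x y <= 1.
Proof.
rewrite /cube_dist; case: ifP => // _.
rewrite ler_pdivrMr ?ltr0n // mul1r ler_nat geq_min.
by rewrite (leq_trans (hamming_le_size x y)).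
Qed.

Lemma cube_dist_lt1 (R : realType) (x y : folded_cubes R) :
  cube_dist x y < 1 -> size x = size y.
Proof. by rewrite /cube_dist; case: eqP => //; rewrite ltxx. Qed.

Lemma cube_distxx (R : realType) (x : folded_cubes R) : cube_dist x x = 0.
Proof. by rewrite /cube_dist eqxx /folded hammingxx min0n mul0r. Qed.

Lemma cube_dist_eq0 (R : realType) (x y : folded_cubes R) :
  cube_dist x y = 0 -> x = y.
Proof.
move=> xy0; have xy : size x = size y by apply: cube_dist_lt1; rewrite xy0.
apply: (hamming_eq0 xy); move: xy0; rewrite /cube_dist xy eqxx -xy.
move=> /eqP; rewrite mulf_eq0 invr_eq0 !pnatr_eq0 orbF /folded => /eqP.
by have := hamming_le_size x y; lia.
Qed.

Lemma cube_distC (R : realType) (x y : folded_cubes R) :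
  cube_dist x y = cube_dist y x.
Proof.
by rewrite /cube_dist eq_sym; case: eqP => // yx; rewrite yx foldedC.
Qed.

Lemma cube_dist_triangle (R : realType) (y x z : folded_cubes R) :
  cube_dist x z <= cube_dist x y + cube_dist y z.
Proof.
have [xy|xy] := eqVneq (size x) (size y); last first.
  rewrite {2}/cube_dist (negPf xy).
  by have := cube_dist_le1 x z; have := cube_dist_ge0 y z; lra.
have [yz|yz] := eqVneq (size y) (size z); last first.
  rewrite {3}/cube_dist (negPf yz).
  by have := cube_dist_le1 x z; have := cube_dist_ge0 x y; lra.
rewrite /cube_dist xy yz eqxx -mulrDl -natrD.
by rewrite ler_pM2r ?invr_gt0 // ler_nat folded_triangle.
Qed.

HB.instance Definition _ (R : realType) :=
  @isMetric.Build R (folded_cubes R) _ (@cube_distxx R) (@cube_dist_eq0 R)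
    (@cube_distC R) (@cube_dist_triangle R).

(** * A Lipschitz co-mixer on the folded cubes *)

Definition xor3 (a b c : seq bool) : seq bool :=
  mkseq (fun i => nth false a i (+) nth false b i (+) nth false c i) (size a).

Lemma xor3_cancel a b : size a = size b ->
  [/\ xor3 a a b = b, xor3 a b a = b & xor3 b a a = b].
Proof.
move=> ab; split; apply: (eq_from_nth (x0 := false)); rewrite size_mkseq // => i ia;
  by rewrite nth_mkseq //; case: (nth _ a _); case: (nth _ b _).
Qed.

(** Addition in a Boolean group is an isometry in each variable separately. *)
Lemma hamming_xor3 a b c a' b' c' : size a = size a' ->
    size b = size a -> size c = size a ->
  [/\ hamming (xor3 a b c) (xor3 a' b c) = hamming a a',
      hamming (xor3 a b c) (xor3 a b' c) = hamming b b' &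
      hamming (xor3 a b c) (xor3 a b c') = hamming c c'].
Proof.
move=> aa' ba ca; rewrite /hamming !size_mkseq ba ca.
split; apply: eq_bigr => i _; rewrite !nth_mkseq -?aa' //.
by case: (nth _ a _); case: (nth _ a' _); case: (nth _ b _); case: (nth _ c _).
by case: (nth _ a _); case: (nth _ b' _); case: (nth _ b _); case: (nth _ c _).
by case: (nth _ a _); case: (nth _ c' _); case: (nth _ b _); case: (nth _ c _).
Qed.

Lemma cube_dist_xor3 (R : realType) (a b c a' b' c' : folded_cubes R) :
    size a = size a' -> size b = size a -> size c = size a ->
    size b = size b' -> size c = size c' ->
  cube_dist (xor3 a b c) (xor3 a' b' c')
    <= cube_dist a a' + cube_dist b b' + cube_dist c c'.
Proof.
move=> aa' ba ca bb' cc'.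
have ba' := etrans ba aa'; have ca' := etrans ca aa'.
have [Ea _ _] := hamming_xor3 b c aa' ba ca.
have [_ Eb _] := hamming_xor3 b' c (erefl (size a')) ba' ca'.
have [_ _ Ec] :=
  hamming_xor3 b' c' (erefl (size a')) (etrans (esym bb') ba') ca'.
apply: le_trans (cube_dist_triangle (xor3 a' b' c : folded_cubes R) _ _) _.
apply: lerD.
  apply: le_trans (cube_dist_triangle (xor3 a' b c : folded_cubes R) _ _) _.
  apply: lerD; first by rewrite /cube_dist /folded Ea !size_mkseq aa'.
  by rewrite /cube_dist /folded Eb !size_mkseq -bb' ba' !eqxx.
by rewrite /cube_dist /folded Ec !size_mkseq -cc' ca' !eqxx.
Qed.

(** The sum inside a component.  Otherwise the value is the argument whose
    component differs from that of the two others; when the three components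
    differ, any choice will do. *)
Definition minority (a b c : seq bool) : seq bool :=
  if size a == size b then if size b == size c then xor3 a b c else c
  else if size a == size c then b else a.

Lemma folded_cubes_comixer (R : realType) :
  admits_lipschitz_comixer (folded_cubes R).
Proof.
pose t (p : folded_cubes R * folded_cubes R * folded_cubes R) :
  folded_cubes R := minority p.1.1 p.1.2 p.2.
have tL : lipschitz3 t.
  exists 3 => -[[a b] c] [[a' b'] c'].
  have := lexx (mdist3 (a, b, c) (a', b', c')).
  rewrite {1}mdist3_triple_le; set m := mdist3 _ _ => /and3P[am bm cm].
  have m0 : 0 <= m by rewrite (le_trans (mdist_ge0 a a')).
  (* Below distance 1, corresponding arguments lie in the same component. *)
  have [m1|m1] := leP 1 m.
    by rewrite (le_trans (cube_dist_le1 _ _)) //; lra.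
  have aa' := cube_dist_lt1 (le_lt_trans am m1).
  have bb' := cube_dist_lt1 (le_lt_trans bm m1).
  have cc' := cube_dist_lt1 (le_lt_trans cm m1).
  have m3 (x : R) : x <= m -> x <= 3 * m by lra.
  rewrite /t /minority /= -aa' -bb' -cc'.
  case: eqP => [ab|_]; last by case: eqP => _; exact: m3.
  case: eqP => [bc|_]; last exact: m3.
  have := cube_dist_xor3 aa' (esym ab) (esym (etrans ab bc)) bb' cc'.
  by move: am bm cm; rewrite /mdist /=; lra.
exists t; split=> //; split; first exact: lipschitz3_continuous.
move=> a b; rewrite /t /minority /=; have [ab|ab] := eqVneq (size a) (size b).
  by have [-> -> ->] := xor3_cancel ab; rewrite ab !eqxx.
by rewrite !eqxx.
Qed.

(** * The winding number modulo 2 of a loop in a folded cube *)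

(** Holds when the antipode of [y] is strictly closer to [x] than [y] is, i.e.
    when the shortest step from [x] to [y] changes sheets in the double cover
    of the folded cube by the cube of dimension [size x + 1]. *)
Definition crossing (x y : seq bool) : bool :=
  ((size x).+1 < 2 * hamming x y)%N.

Lemma crossingxx x : crossing x x = false.
Proof. by rewrite /crossing hammingxx. Qed.

(** The lifts of the three edges of a triangle of perimeter less than the
    distance between antipodes form a closed path, so the number of changes of
    sheet is even.  In numbers: a single crossing contradicts the triangle
    inequality, and three crossings contradict the bound on the perimeter. *)
Lemma crossing_cocycle (R : realType) (x y z : folded_cubes R) :
    3 * cube_dist x y < 1 -> 3 * cube_dist y z < 1 -> 3 * cube_dist x z < 1 ->
  crossing x y (+) crossing y z = crossing x z.
Proof.
have close (u v : folded_cubes R) : 3 * cube_dist u v < 1 ->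
    size u = size v /\ (3 * folded u v < (size u).+1)%N.
  move=> uv; have suv : size u = size v.
    by apply: cube_dist_lt1; have := cube_dist_ge0 u v; lra.
  split=> //; move: uv; rewrite /cube_dist suv eqxx mulrA.
  by rewrite ltr_pdivrMr ?ltr0n // mul1r -natrM ltr_nat.
move=> /close[xy cxy] /close[yz cyz] /close[xz cxz].
have := hamming_triangle z xy; have := hamming_perimeter z xy.
have := hamming_triangle y xz; have := hamming_triangle z (esym xy).
move: cxy cyz cxz; rewrite (hammingC (esym xy)) (hammingC (esym yz)).
rewrite /crossing /folded -xy.
have := hamming_le_size x y; have := hamming_le_size x z.
move: (hamming x y) (hamming y z) (hamming x z) (size x) => p q r n.
by case: ltnP; case: ltnP; case: ltnP => //=; lia.
Qed.

Definition winding (n : nat) (p : nat -> seq bool) : bool :=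
  \big[addb/false]_(i < n) crossing (p i) (p i.+1).

Lemma windingS n p :
  winding n.+1 p = winding n p (+) crossing (p n) (p n.+1).
Proof. exact: big_ord_recr. Qed.

(** Additivity on the two halves of the square with corners [p i], [p i.+1],
    [q i], [q i.+1] makes the difference of the partial sums equal to the
    crossing of the transverse edge, which is trivial at the common ends. *)
Lemma winding_homotopy (R : realType) (n : nat) (p q : nat -> folded_cubes R) :
    p 0%N = q 0%N -> p n = q n ->
    (forall i, [/\ 3 * cube_dist (p i) (p i.+1) < 1,
                   3 * cube_dist (q i) (q i.+1) < 1,
                   3 * cube_dist (p i) (q i) < 1 &
                   3 * cube_dist (p i) (q i.+1) < 1]) ->
  winding n p = winding n q.
Proof.
move=> pq0 pqn close.
suff W k : winding k p (+) winding k q = crossing (p k) (q k).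
  by have := W n; rewrite pqn crossingxx; do 2!case: winding.
elim: k => [|k IHk]; first by rewrite /winding !big_ord0 pq0 crossingxx.
rewrite !windingS addbACA IHk.
have [pp qq pq pq'] := close k; have [_ _ pq1 _] := close k.+1.
have := crossing_cocycle pp pq1 pq'; have := crossing_cocycle pq qq pq'.
by move=> <-; do 4!case: crossing.
Qed.

(** * No Lipschitz mixer on the folded cubes *)

(** The path from the zero word through the words [1...10...0] to the word of
    ones, followed by the zero word again: the bound [i <= N] makes the
    sequence return to zero at [N + 1], where the antipodal identification
    closes the loop. *)
Definition prefix_loop (N i : nat) : seq bool :=
  mkseq (fun k => (k < i <= N)%N) N.

Lemma size_prefix_loop N i : size (prefix_loop N i) = N.
Proof. exact: size_mkseq. Qed.

Lemma prefix_loop_closed N : prefix_loop N N.+1 = prefix_loop N 0.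
Proof. by apply: eq_mkseq => k; rewrite ltnn andbF. Qed.

Lemma hamming_prefix_loop N i : (i < N)%N ->
  hamming (prefix_loop N i) (prefix_loop N i.+1) = 1%N.
Proof.
move=> iN; rewrite /hamming size_prefix_loop (bigD1 (Ordinal iN)) //=.
rewrite !nth_mkseq // ltnn ltnSn iN big1 ?addn0 // => k ki.
rewrite !nth_mkseq // (ltnW iN) iN !andbT ltnS.
by have : val k != i by []; case: ltngtP.
Qed.

Lemma hamming_prefix_loop_last N :
  hamming (prefix_loop N N) (prefix_loop N N.+1) = N.
Proof.
rewrite /hamming size_prefix_loop -[RHS]card_ord -sum1_card.
by apply: eq_bigr => k _; rewrite !nth_mkseq // ltn_ord leqnn ltnn andbF.
Qed.

Lemma cube_dist_prefix_loop (R : realType) N i :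
  @cube_dist R (prefix_loop N i) (prefix_loop N i.+1) <= N.+1%:R^-1.
Proof.
rewrite /cube_dist !size_prefix_loop eqxx -[leRHS]mul1r.
rewrite ler_pM2r ?invr_gt0 // -[1]/(1%:R) ler_nat /folded size_prefix_loop.
case: (ltngtP i N) => [iN|Ni|->].
- by rewrite hamming_prefix_loop // geq_min leqnn.
- suff -> : prefix_loop N i.+1 = prefix_loop N i by rewrite hammingxx min0n.
  by apply: eq_mkseq => k; lia.
- by rewrite hamming_prefix_loop_last geq_min subSnn leqnn orbT.
Qed.

(** Only the closing step crosses. *)
Lemma winding_prefix_loop N : (1 < N)%N -> winding N.+1 (prefix_loop N).
Proof.
move=> N1; rewrite windingS /winding big1 => [|i _].
  by rewrite /crossing hamming_prefix_loop_last size_prefix_loop; lia.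
rewrite /crossing hamming_prefix_loop // size_prefix_loop; lia.
Qed.

(** The loops [lambda t], [t <= N + 1], form a homotopy with small steps from
    the constant loop to [prefix_loop N]. *)
Lemma folded_cubes_no_mixer (R : realType) :
  ~ admits_lipschitz_mixer (folded_cubes R).
Proof.
move=> [s [[_ sE] /lipschitz3_constant[K K0 sK]]].
(* The images of points at distance 1/(N + 1) are less than 1/3 apart, as
   the cocycle condition requires. *)
pose N := (Num.bound (3 * K)).+2.
have KN : 3 * (K * N.+1%:R^-1) < 1.
  rewrite mulrA ltr_pdivrMr ?ltr0n // mul1r.
  have : 3 * K < (Num.bound (3 * K))%:R by apply: archi_boundP; lra.
  by move=> /lt_le_trans; apply; rewrite ler_nat; lia.
pose g : nat -> folded_cubes R := prefix_loop N.
have gN : g N.+1 = g 0%N by exact: prefix_loop_closed.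
have gS i : mdist (g i) (g i.+1) <= N.+1%:R^-1 by exact: cube_dist_prefix_loop.
have gg (a : folded_cubes R) : mdist a a <= N.+1%:R^-1.
  by rewrite mdistxx invr_ge0.
have gmin i t : [/\ mdist (g (minn i t)) (g (minn i.+1 t)) <= N.+1%:R^-1,
    mdist (g (minn i t)) (g (minn i t.+1)) <= N.+1%:R^-1 &
    mdist (g (minn i t)) (g (minn i.+1 t.+1)) <= N.+1%:R^-1].
  rewrite minnSS; split=> //; have [it|ti] := ltnP i t.
  - by rewrite !(minn_idPl _) // ltnW.
  - by rewrite !(minn_idPr _) // ltnW.
  - by rewrite !(minn_idPl _) // ltnW // ltnW.
  - move: ti; rewrite leq_eqVlt => /predU1P[->|ti].
      by rewrite (minn_idPl _).
    by rewrite (minn_idPr ti).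
pose lambda t i := s (g i, g (minn i t), g 0%N).
have close (a a' b b' : folded_cubes R) : mdist a a' <= N.+1%:R^-1 ->
    mdist b b' <= N.+1%:R^-1 ->
    3 * cube_dist (s (a, b, g 0%N)) (s (a', b', g 0%N)) < 1.
  move=> aa' bb'.
  have /sK : mdist3 (a, b, g 0%N) (a', b', g 0%N) <= N.+1%:R^-1.
    by rewrite mdist3_triple_le aa' bb' gg.
  rewrite {1}/mdist /=; move: (K / _) KN => ? ?; lra.
have homotopy t : winding N.+1 (lambda t) = winding N.+1 (lambda t.+1).
  have l0 u : lambda u 0%N = g 0%N.
    by rewrite /lambda min0n; have [] := sE (g 0%N) (g 0%N).
  have lN u : lambda u N.+1 = g 0%N.
    by rewrite /lambda gN; have [_ ->] := sE (g 0%N) (g (minn N.+1 u)).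
  apply: (@winding_homotopy R); rewrite ?l0 ?lN // => i.
  have [tt' tS tSS] := gmin i t; have [tt'S _ _] := gmin i t.+1.
  by split; apply: close.
have l0 : winding N.+1 (lambda 0%N) = false.
  apply: big1 => i _; rewrite /lambda !minn0.
  have [_ _ ->] := sE (g 0%N) (g i).
  by have [_ _ ->] := sE (g 0%N) (g i.+1); rewrite crossingxx.
have lN : winding N.+1 (lambda N.+1) = winding N.+1 (prefix_loop N).
  apply: eq_bigr => i _; rewrite /lambda !(minn_idPl _) //; last exact: ltnW.
  by have [-> _ _] := sE (g i) (g 0%N); have [-> _ _] := sE (g i.+1) (g 0%N).
have lt t : winding N.+1 (lambda t) = false.
  by elim: t => [|t IHt]; rewrite -?homotopy.
by have := lt N.+1; rewrite lN winding_prefix_loop.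
Qed.

Theorem mainTheorem3 (R : realType) :
  (exists X : metricType R,
     admits_lipschitz_mixer X /\ ~ admits_lipschitz_comixer X) /\
  (exists X : metricType R,
     admits_lipschitz_comixer X /\ ~ admits_lipschitz_mixer X).
Proof.
split.
  exists (gapped_line R); split; first exact: gapped_line_mixer.
  exact: gapped_line_no_comixer.
exists (folded_cubes R); split; first exact: folded_cubes_comixer.
exact: folded_cubes_no_mixer.
Qed.
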